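(* Let $\Gamma$ be a countable, proximal, boundedly supported group of orientation-preserving homeomorphisms of the real line, with derived subgroup $\Gamma'$. Let $\mathcal{S}$ be the family of finite symmetric groups equipped with the normalized Hamming distance. Then every uniform asymptotic homomorphism $\phi_n:\Gamma'\to S_{k_n}\in\mathcal{S}$ is uniformly asymptotically close to the trivial one. In particular, $\Gamma'$ is uniformly $\mathcal{S}$-stable, and not uniformly $\mathcal{S}$-approximable.
   Context: All groups are discrete and countable. A group $\Gamma$ acting by homeomorphisms on $\mathbb{R}$ is *proximal* if for all reals $a<b$ and $c<d$ there exists $g\in\Gamma$ with $g\cdot a<c<d<g\cdot b$. The *support* of $g$ is $\{x\in\mathbb{R}:g\cdot x\ne x\}$; $\Gamma$ is *boundedly supported* if every element has bounded support. The normalized Hamming distance on the symmetric group $S_k$ is $d_k(\sigma,\tau)=\frac1k|\{i:\sigma(i)\ne\tau(i)\}|$. For a group $G$, a *uniform asymptotic homomorphism* to $\mathcal{S}$ is a sequence of maps $\phi_n:G\to S_{k_n}$ with $\sup_{g,h\in G}d_{k_n}(\phi_n(gh),\phi_n(g)\phi_n(h))\to0$. Two sequences $\phi_n,\psi_n:G\to S_{k_n}$ are *uniformly asymptotically close* if $\sup_{g\in G}d_{k_n}(\phi_n(g),\psi_n(g))\to0$; the trivial one is the sequence of trivial homomorphisms. $G$ is *uniformly $\mathcal{S}$-stable* if every uniform asymptotic homomorphism $\phi_n:G\to S_{k_n}$ is uniformly asymptotically close to a sequence of homomorphisms $G\to S_{k_n}$. $G$ is *uniformly $\mathcal{S}$-approximable*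 if there is a uniform asymptotic homomorphism $\phi_n:G\to S_{k_n}$ with $\liminf_{n\to\infty}d_{k_n}(\phi_n(g),\operatorname{id})>0$ for every $g\in G$, $g\neq1$. *)

(* Defs.v *)
From HB Require Import structures.
From mathcomp Require Import all_boot all_order all_algebra all_fingroup.
From mathcomp Require Import all_classical all_reals all_analysis.

Set Implicit Arguments.
Unset Strict Implicit.
Unset Printing Implicit Defensive.

Import Order.TTheory GRing.Theory Num.Theory numFieldNormedType.Exports.

Local Open Scope classical_set_scope.
Local Open Scope ring_scope.

Definition subgroup_type (G : groupType) (H : groupClosed G) : Type :=
  {x : G | x \in H}.

Section SubgroupType.
Context (G : groupType) (H : groupClosed G).

Lemma groupClosed_group_closed : group_closed H.
Proof. by split; [exact: gpred1 | exact: gpredF]. Qed.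

HB.instance Definition _ := [isSub of subgroup_type H for sval].
HB.instance Definition _ := [Choice of subgroup_type H by <:].
HB.instance Definition _ :=
  SubChoice_isSubGroup.Build G _ (subgroup_type H) groupClosed_group_closed.

End SubgroupType.

Definition derived_pred (G : groupType) (H : groupClosed G) : {pred G} :=
  fun x => `[< forall K : groupClosed G,
    (forall y z, y \in H -> z \in H -> [~ y, z]%g \in K) -> x \in K >].

Section DerivedSubgroup.
Context (G : groupType) (H : groupClosed G).

Lemma derived_pred1 : 1%g \in derived_pred H.
Proof. by apply/asboolP => K _; exact: gpred1. Qed.

Lemma derived_predM : mulg_closed (derived_pred H).
Proof.
move=> x y /asboolP Dx /asboolP Dy; apply/asboolP => K HK.
by apply: gpredM; [exact: Dx | exact: Dy].
Qed.

Lemma derived_predV : invg_closed (derived_pred H).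
Proof.
by move=> x /asboolP Dx; apply/asboolP => K HK; apply: gpredVr; exact: Dx.
Qed.

(* The smallest subgroup containing all the commutators of elements of H.
   The structure is packed by hand because HB.instance does not produce the
   UMagmaClosed and GroupClosed instances of derived_pred. *)
Definition derived_subgroup : groupClosed G :=
  GroupClosed.Pack (GroupClosed.Class
    (isInvClosed.Build G (derived_pred H) derived_predV)
    (isMul1Closed.Build G (derived_pred H) derived_pred1)
    (isMulClosed.Build G (derived_pred H) derived_predM)).

End DerivedSubgroup.

Definition is_homeop (R : realType) (f : R -> R) : Prop :=
  [/\ {homo f : x y / x < y}, continuous f &
      exists g : R -> R, [/\ cancel f g, cancel g f & continuous g]].

Record homeop (R : realType) := Homeop {
  homeop_fun :> R -> R;
  _ : `[< is_homeop homeop_fun >]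
}.

Section HomeopGroup.
Context (R : realType).

HB.instance Definition _ := [isSub for @homeop_fun R].
HB.instance Definition _ := [Choice of homeop R by <:].

Implicit Types f g h : homeop R.

Lemma homeop_funP f : is_homeop f.
Proof. by case: f => f /= /asboolP. Qed.

Lemma homeop_ext f g : f =1 g -> f = g.
Proof. by move=> fg; apply/val_inj/funext. Qed.

Lemma is_homeop_id : is_homeop (idfun : R -> R).
Proof. by split=> // [x|]; [exact: cvg_id | exists id; split=> // x; exact: cvg_id]. Qed.

Definition homeop_one : homeop R := Homeop (asboolT is_homeop_id).

Lemma is_homeop_comp f g : is_homeop (f \o g).
Proof.
have [fI fC [f' [fK fK' f'C]]] := homeop_funP f.
have [gI gC [g' [gK gK' g'C]]] := homeop_funP g.
split=> [x y xy|x|]; first by apply/fI/gI.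
  by apply: continuous_comp; [exact: gC | exact: fC].
exists (g' \o f'); split; [exact: can_comp | exact: can_comp |].
by move=> x; apply: continuous_comp; [exact: f'C | exact: g'C].
Qed.

Definition homeop_mul f g : homeop R := Homeop (asboolT (is_homeop_comp f g)).

Lemma homeop_inv_ex f :
  exists g : R -> R, [/\ cancel f g, cancel g f & is_homeop g].
Proof.
have [fI fC [g [fK gK gC]]] := homeop_funP f.
exists g; split=> //; split=> //; last by exists f.
move=> x y xy; rewrite ltNge; apply/negP => gyx.
have : f (g y) <= f (g x).
  by move: gyx; rewrite le_eqVlt => /predU1P[->//|/fI/ltW].
by rewrite !gK leNgt xy.
Qed.

Definition homeop_inv f : homeop R :=
  let: exist g gP := cid (homeop_inv_ex f) in
  let: And3 _ _ gH := gP in Homeop (asboolT gH).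

Lemma homeop_invK f : cancel f (homeop_inv f) /\ cancel (homeop_inv f) f.
Proof. by rewrite /homeop_inv; case: cid => g []. Qed.

Lemma homeop_mulA : associative homeop_mul.
Proof. by move=> f g h; exact: homeop_ext. Qed.

Lemma homeop_mul1 : left_id homeop_one homeop_mul.
Proof. by move=> f; exact: homeop_ext. Qed.

Lemma homeop_mulr1 : right_id homeop_one homeop_mul.
Proof. by move=> f; exact: homeop_ext. Qed.

Lemma homeop_mulV : left_inverse homeop_one homeop_inv homeop_mul.
Proof. by move=> f; apply: homeop_ext => x; exact: (homeop_invK f).1. Qed.

Lemma homeop_mulrV : right_inverse homeop_one homeop_inv homeop_mul.
Proof. by move=> f; apply: homeop_ext => x; exact: (homeop_invK f).2. Qed.

HB.instance Definition _ := isGroup.Build (homeop R)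
  homeop_mulA homeop_mul1 homeop_mulr1 homeop_mulV homeop_mulrV.

Definition support (g : homeop R) : set R := [set x | g x != x].

Definition proximal (Gamma : groupClosed (homeop R)) : Prop :=
  forall a b c d : R, a < b -> c < d ->
    exists2 g, g \in Gamma & g a < c /\ d < g b.

Definition boundedly_supported (Gamma : groupClosed (homeop R)) : Prop :=
  forall g, g \in Gamma -> bounded_set (support g).

End HomeopGroup.

(* The product of 'S_k composes permutations from left to right, that of
   homeop from right to left.  This is immaterial for the notions below:
   inversion is an isomorphism of 'S_k with its opposite group and an isometry
   for d_hamming. *)

Definition d_hamming (R : realType) (k : nat) (s t : 'S_k) : R :=
  #|[set i | s i != t i]|%:R / k%:R.

Section Asymptotic.
Context (R : realType) (G : groupType).
Implicit Type k : nat -> nat.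
Local Open Scope ereal_scope.

Definition uniform_asymptotic_hom k (phi : forall n, G -> 'S_(k n)) : Prop :=
  ereal_sup [set (d_hamming R (phi n (gh.1 * gh.2)%g)
                              (phi n gh.1 * phi n gh.2)%g)%:E
            | gh in [set: G * G]] @[n --> \oo] --> 0.

Definition uniformly_asymptotically_close k
    (phi psi : forall n, G -> 'S_(k n)) : Prop :=
  ereal_sup [set (d_hamming R (phi n g) (psi n g))%:E | g in [set: G]]
    @[n --> \oo] --> 0.

Definition trivial_hom k : forall n, G -> 'S_(k n) := fun n g => 1%g.

Definition uniformly_S_stable : Prop :=
  forall k, (forall n, 0 < k n)%N ->
  forall phi : forall n, G -> 'S_(k n), uniform_asymptotic_hom phi ->
  exists psi : forall n, {multiplicative G -> 'S_(k n)},
    uniformly_asymptotically_close phi psi.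

Definition uniformly_S_approximable : Prop :=
  exists k, (forall n, 0 < k n)%N /\
  exists phi : forall n, G -> 'S_(k n), uniform_asymptotic_hom phi /\
  forall g : G, g <> 1%g ->
    0 < limn_einf (fun n => (d_hamming R (phi n g) 1%g)%:E).

End Asymptotic.

(* Main.v *)
Require Import Defs.
From mathcomp Require Import all_boot all_order all_algebra all_fingroup.
From mathcomp Require Import all_classical all_reals all_analysis.
From mathcomp Require Import lra.

(** Let [l g] be the Hamming distance from [phi g] to the identity, where [phi]
    is a homomorphism up to [e].  Among the infinitely many powers of an element
    of [Gamma'] displacing a given bounded interval, two have the same image
    because ['S_k] is finite; hence some displacing [t] has [l t <= e].  If [a]
    and [b] are supported in the interval then [[a, b] = [[a^-1, t], b]], so
    that [l [a, b]] is at most a universal multiple of [e].  Displacement also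
    shows that every element of [Gamma'] is a product of two commutators of
    elements of [Gamma'], so [l] is bounded by a universal multiple of [e]. *)

Set Implicit Arguments.
Unset Strict Implicit.
Unset Printing Implicit Defensive.

Import Order.TTheory GRing.Theory Num.Theory numFieldNormedType.Exports.

Local Open Scope ring_scope.

(** * Commutator identities in an abstract group *)

Section Commutators.
Context (G : groupType).
Implicit Types a b c t x y : G.
Local Open Scope group_scope.

Lemma mulgACA a b x y : commute b x -> a * b * (x * y) = a * x * (b * y).
Proof. by move=> bx; rewrite -!mulgA (mulgA b) [b * x]bx -mulgA. Qed.

Lemma commgEV x y : [~ x, y] = (y * x)^-1 * (x * y).
Proof. by rewrite /commg /conjg invgM !mulgA. Qed.

Lemma commuteR x a b : commute x a -> commute x b -> commute x [~ a, b].
Proof.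
by move=> xa xb; rewrite commgEV; apply: commuteM; first apply: commuteV;
  apply: commuteM.
Qed.

Lemma commuteJ x y t : commute x y -> commute (x ^ t) (y ^ t).
Proof. by rewrite /commute -!conjMg => ->. Qed.

(** Each of [a], [b] commutes with each of [x], [y], so the commutator is computed as in a direct
    product. *)
Lemma commgM_commute a b x y :
    commute a x -> commute a y -> commute b x -> commute b y ->
  [~ a * x, b * y] = [~ a, b] * [~ x, y].
Proof.
move=> ax ay bx yb.
have -> : [~ a * x, b * y] = (y * x)^-1 * [~ a, b] * (x * y).
  rewrite [LHS]commgEV (mulgACA _ _ (commute_sym ay)).
  by rewrite (mulgACA _ _ (commute_sym bx)) invgM commgEV !mulgA.
suff -> : (y * x)^-1 * [~ a, b] = [~ a, b] * (y * x)^-1.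
  by rewrite -mulgA (commgEV x).
apply/commute_sym/commuteV/commute_sym/commuteR; apply: commute_sym;
  exact: commuteM.
Qed.

(* Conjugating the three factors by [1], [t] and [t ^+ 2] makes them commute, so
   that their product becomes one commutator; the error telescopes to a
   commutator with [t]. *)
Lemma mul3_commg t a1 b1 a2 b2 a3 b3 :
    {in [:: a1; b1; a2; b2; a3; b3] & [:: a2; b2; a3; b3],
      forall x y, commute x (y ^ t) /\ commute x ((y ^ t) ^ t)} ->
  [~ a1, b1] * [~ a2, b2] * [~ a3, b3] =
  [~ a1 * a2 ^ t * (a3 ^ t) ^ t, b1 * b2 ^ t * (b3 ^ t) ^ t] *
  [~ ([~ a2, b2] * [~ a3, b3] * [~ a3, b3] ^ t)^-1, t].
Proof.
move=> H.
have H1 x y : x \in [:: a1; b1; a2; b2; a3; b3] -> y \in [:: a2; b2; a3; b3] ->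
  commute x (y ^ t) by move=> xP yP; case: (H x y xP yP).
have H2 x y : x \in [:: a1; b1; a2; b2; a3; b3] -> y \in [:: a2; b2; a3; b3] ->
  commute x ((y ^ t) ^ t) by move=> xP yP; case: (H x y xP yP).
have H3 x y : x \in [:: a1; b1; a2; b2; a3; b3] -> y \in [:: a2; b2; a3; b3] ->
  commute (x ^ t) ((y ^ t) ^ t)
  by move=> xP yP; apply: commuteJ; exact: H1.
have S x y z : commute x z -> commute y z -> commute (x * y) z.
  by move=> xz yz; apply/commute_sym/commuteM; exact: commute_sym.
rewrite (@commgM_commute (a1 * _) (b1 * _)) ?(@commgM_commute a1 b1);
  try (by apply: H1; rewrite !inE eqxx ?orbT);
  try (by apply: S; [apply: H2 | apply: H3]; rewrite !inE eqxx ?orbT).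
rewrite -!conjRg; set c1 := [~ a1, b1]; set c2 := [~ a2, b2]; set c3 := [~ a3, b3].
have SR x y u v : commute x u -> commute x v -> commute y u -> commute y v ->
    commute [~ x, y] [~ u, v].
  by move=> *; apply: commuteR; apply/commute_sym/commuteR; exact: commute_sym.
have C x y u v : x \in [:: a2; b2; a3; b3] -> y \in [:: a2; b2; a3; b3] ->
    u \in [:: a2; b2; a3; b3] -> v \in [:: a2; b2; a3; b3] ->
  [/\ commute [~ x, y] ([~ u, v] ^ t), commute [~ x, y] (([~ u, v] ^ t) ^ t) &
      commute ([~ x, y] ^ t) (([~ u, v] ^ t) ^ t)].
  have I z : z \in [:: a2; b2; a3; b3] -> z \in [:: a1; b1; a2; b2; a3; b3].
    by rewrite !inE => /or4P[] ->; rewrite !orbT.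
  move=> xi yi ui vi; rewrite !conjRg.
  split; apply: SR; by [apply: H1; auto | apply: H2; auto| apply: H3; auto].
have [||||c22t _ _] := C a2 b2 a2 b2; rewrite ?inE ?eqxx ?orbT //.
have [||||c23t c23tt c2t3tt] := C a2 b2 a3 b3; rewrite ?inE ?eqxx ?orbT //.
have [||||c32t _ _] := C a3 b3 a2 b2; rewrite ?inE ?eqxx ?orbT //.
have [||||c33t c33tt c3t3tt] := C a3 b3 a3 b3; rewrite ?inE ?eqxx ?orbT //.
rewrite -/c2 -/c3 in c22t c23t c23tt c2t3tt c32t c33t c33tt c3t3tt.
clearbody c1 c2 c3.
rewrite commgEl invgK conjVg (conjMg (c2 * c3)) (conjMg c2).
set u := c2 ^ t in c22t c32t c2t3tt *.
set v := c3 ^ t in c23t c33t c3t3tt *.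
set w := v ^ t in c23tt c2t3tt c33tt c3t3tt *.
clearbody w; clearbody u v.
rewrite !invgM -!mulgA; congr (_ * _).
(* [u], [v], [w] are the conjugates of [c2], [c3], [c3] by [t], [t], [t ^+ 2]. Moving [w^-1] past
   [v] cancels [v]; then [u] and [w] commute with [c2 * c3]. *)
suff -> : c2 * (c3 * (v * (w^-1 * (v^-1 * u^-1)))) = w^-1 * (u^-1 * (c2 * c3)).
  by rewrite mulKVg mulKVg.
have -> : v * (w^-1 * (v^-1 * u^-1)) = w^-1 * u^-1.
  rewrite [LHS]mulgA [v * w^-1](commuteV c3t3tt) -mulgA; congr (_ * _).
  by rewrite mulgA mulgV mul1g.
rewrite mulgA.
have cw : commute (c2 * c3) w^-1 by apply/commuteV; exact: S.
have cu : commute (c2 * c3) u^-1 by apply/commuteV; exact: S.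
by rewrite [LHS]mulgA [_ * w^-1]cw -mulgA [_ * u^-1]cu.
Qed.
End Commutators.

(** * The Hamming distance as a bi-invariant metric *)

Section Hamming.
Context (R : realType) (k : nat).
Implicit Types s t u : 'S_k.
Local Notation d := (@d_hamming R k).

Lemma d_hammingE s t : d s t = #|[pred i | s i != t i]|%:R / k%:R.
Proof.
rewrite /d_hamming; congr (_%:R / _); apply: eq_card => i.
by apply/idP/idP => [/set_mem|/mem_set].
Qed.

Lemma d_hamming_ge0 s t : 0 <= d s t.
Proof. by rewrite d_hammingE divr_ge0. Qed.

Lemma d_hamming_sym s t : d s t = d t s.
Proof.
rewrite !d_hammingE; congr (_%:R / _); apply: eq_card => i.
by rewrite !inE eq_sym.
Qed.

Lemma d_hamming_triangle s t u : d s u <= d s t + d t u.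
Proof.
rewrite !d_hammingE -mulrDl ler_wpM2r ?invr_ge0// -natrD ler_nat -cardUI.
apply: leq_trans (leq_addr _ _); apply/subset_leq_card/fintype.subsetP => i.
by rewrite !inE; case: (s i =P t i) => [->|].
Qed.

Lemma d_hamming_mull u s t : d (u * s)%g (u * t)%g = d s t.
Proof.
rewrite !d_hammingE; congr (_%:R / _).
have uI : injective u by exact: perm_inj.
rewrite -(card_imset _ uI); apply: eq_card => i.
by rewrite -[i](permKV u) mem_imset ?inE ?permM//.
Qed.

Lemma d_hamming_mulr u s t : d (s * u)%g (t * u)%g = d s t.
Proof.
rewrite !d_hammingE; congr (_%:R / _); apply: eq_card => i.
by rewrite !inE !permM (inj_eq perm_inj).
Qed.

End Hamming.

(** * Lengths under a homomorphism up to [e] *)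

Section AlmostHom.
Context (R : realType) (G : groupType) (k : nat) (phi : G -> 'S_k) (e : R).
Hypothesis phiM : forall x y, d_hamming R (phi (x * y)%g) (phi x * phi y)%g <= e.
Implicit Types x y z : G.
Local Notation d := (@d_hamming R k).
Local Notation l x := (d (phi x) 1%g).

Let lMl u s : d (u * s)%g u = d s 1%g.
Proof. by rewrite -(d_hamming_mull R u s) mulg1. Qed.

Let lMr u s : d (s * u)%g u = d s 1%g.
Proof. by rewrite -(d_hamming_mulr R u s) mul1g. Qed.

Lemma almost_hom1 : l 1%g <= e.
Proof. by have := phiM 1%g 1%g; rewrite mul1g d_hamming_sym lMr. Qed.

Lemma almost_hom_mul x y : l (x * y)%g <= l x + l y + e.
Proof.
have := d_hamming_triangle R (phi (x * y)%g) (phi x * phi y)%g 1%g.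
have := d_hamming_triangle R (phi x * phi y)%g (phi y) 1%g.
have := phiM x y; rewrite lMr; lra.
Qed.

Lemma almost_hom_inv x : l x^-1%g <= l x + 2 * e.
Proof.
have := phiM x^-1%g x; have := almost_hom1; rewrite mulVg => h1 h2.
have := d_hamming_triangle R (phi x^-1 * phi x)%g (phi 1)%g 1%g.
have := d_hamming_triangle R (phi x^-1)%g (phi x^-1 * phi x)%g 1%g.
rewrite d_hamming_sym in h2.
by rewrite (d_hamming_sym _ (phi x^-1)%g (_ * _)%g) lMl; lra.
Qed.

(** As [y * x ^ y = x * y], both [phi y * phi (x ^ y)] and [phi x * phi y] are within [e] of
    [phi (x * y)]; by bi-invariance their distances to [phi y] are the two lengths. *)
Lemma almost_hom_conj x y : l (x ^ y)%g <= l x + 2 * e.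
Proof.
have h1 := phiM y (x ^ y)%g; have h2 := phiM x y.
have := d_hamming_triangle R (phi y * phi (x ^ y)%g)%g (phi (x * y)%g) (phi y).
have := d_hamming_triangle R (phi (x * y)%g) (phi x * phi y)%g (phi y).
by rewrite lMl lMr; rewrite conjgE mulVKg d_hamming_sym in h1 *; lra.
Qed.

Lemma almost_hom_comm x y : l [~ x, y]%g <= 2 * l x + 5 * e.
Proof.
have := almost_hom_mul x^-1%g (x ^ y)%g; rewrite -commgEl.
have := almost_hom_inv x; have := almost_hom_conj x y; lra.
Qed.

(* Two of the infinitely many powers of [x] have the same image in the finite
   group ['S_k]. *)
Lemma almost_hom_power x : exists n, l (x ^+ n.+1)%g <= e.
Proof.
pose f (i : 'I_(#|{perm 'I_k}|.+1)) := phi (x ^+ i)%g.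
have /injectivePn[i [j ij fij]] : ~~ injectiveb f.
  by apply/negP => /injectiveP/leq_card; rewrite card_ord ltnn.
wlog lt_ij : i j ij fij / (i < j)%N.
  move=> H; have : (i : nat) != j by []; rewrite neq_ltn.
  by move=> /orP[/H|/H]; apply; rewrite // eq_sym.
(* The exponent [j - i] is positive, which matters later: a zeroth power displaces nothing. *)
exists (j - i).-1; rewrite prednK ?subn_gt0//.
have := phiM (x ^+ i)%g (x ^+ (j - i))%g.
rewrite -expgnDr subnKC 1?ltnW// -[phi _]fij.
by rewrite d_hamming_sym lMl.
Qed.

End AlmostHom.

(** * Homeomorphisms displacing a bounded interval *)

Section Displacement.
Context (R : realType).
Implicit Types (f g h s t : homeop R) (M : R).

Lemma homeopME f g x : (f * g)%g x = f (g x).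
Proof. by []. Qed.

Lemma homeop1E x : (1 : homeop R)%g x = x.
Proof. by []. Qed.

Lemma homeopVK f x : f^-1%g (f x) = x.
Proof. by rewrite -homeopME mulVg. Qed.

Lemma homeopKV f x : f (f^-1%g x) = x.
Proof. by rewrite -homeopME mulgV. Qed.

Lemma homeop_lt f x y : x < y -> f x < f y.
Proof. by have [fI _ _] := homeop_funP f; exact: fI. Qed.

Lemma homeop_le f x y : x <= y -> f x <= f y.
Proof. by rewrite le_eqVlt => /predU1P[->//|xy]; exact/ltW/homeop_lt. Qed.

Lemma homeop_inj f : injective f.
Proof. exact: can_inj (homeopVK f). Qed.

Lemma disjoint_commute f g : (forall x, f x = x \/ g x = x) -> commute f g.
Proof.
move=> fg; apply: homeop_ext => x; rewrite !homeopME.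
have [fx|gx] := fg x.
  rewrite fx; have [//|/homeop_inj gx] := fg (g x); by rewrite gx fx.
rewrite gx; have [/homeop_inj fx|//] := fg (f x); by rewrite fx gx.
Qed.

Definition fixes_outside M g := forall x, M < `|x| -> g x = x.

(** By monotonicity, [t] pushes the whole interval [[- M, M]] to the right of [M]. This one-sided
    form passes to products and positive powers when [0 < M]. *)
Definition displaces M t := M < t (- M).

Lemma fixes_outsideV M g : fixes_outside M g -> fixes_outside M g^-1%g.
Proof. by move=> gM x /gM gx; apply: (@homeop_inj g); rewrite homeopKV gx. Qed.

(** A point of [[- M, M]] is sent by [t] beyond [M], where [g] is the identity, so [t^-1 * g * t]
    fixes it; elsewhere [f] is the identity. *)
Lemma displaced_commute M t f g :
  fixes_outside M f -> fixes_outside M g -> displaces M t -> commute f (g ^ t)%g.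
Proof.
move=> fM gM tM; apply: disjoint_commute => x.
have [|xM] := ltP M `|x|; [by left; apply: fM | right].
rewrite conjgE !homeopME gM ?homeopVK//.
apply: lt_le_trans (ler_norm _); apply: lt_le_trans tM _; apply: homeop_le.
by move: xM; rewrite ler_norml => /andP[].
Qed.

Lemma displacesM M s t : 0 < M -> displaces M s -> displaces M t ->
  displaces M (s * t)%g.
Proof.
move=> M0 sM tM; rewrite /displaces homeopME; apply: lt_trans sM _.
by apply: homeop_lt; apply: lt_trans tM; rewrite gtrN.
Qed.

Lemma displacesX M t n : 0 < M -> displaces M t -> displaces M (t ^+ n.+1)%g.
Proof.
move=> M0 tM; elim: n => // n IH; rewrite expgS; exact: displacesM.
Qed.

(** * Displacing elements and commutators in [Gamma] *)

Context (Gamma : groupClosed (homeop R)).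
Hypothesis proxG : proximal Gamma.
Hypothesis bndG : boundedly_supported Gamma.

Lemma near_fixes_outside g : g \in Gamma -> \forall M \near +oo, fixes_outside M g.
Proof.
move=> /bndG; rewrite /= /bounded_near; apply: filterS => M gM x Mx; apply/eqP/negPn/negP => gx.
by have : `|x| <= M := gM x gx; rewrite leNgt Mx.
Qed.

Lemma displacing_element M : 0 < M -> exists2 t, t \in Gamma & displaces M t.
Proof.
move=> M0; have M2 : - M < M by rewrite gtrN.
have lt1 : - M - 1 < - M by rewrite gtrDl oppr_lt0.
by have [t tG [_ tM]] := proxG lt1 M2; exists t.
Qed.

Lemma common_bound (r : seq (homeop R)) : {subset r <= Gamma} ->
  exists2 M, 0 < M & {in r, forall g, fixes_outside M g}.
Proof.
move=> rG; apply: pinfty_ex_gt0.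
elim: r rG => [|g r IH] rG; first by apply: nearW => M x; rewrite in_nil.
have gG : g \in Gamma by apply: rG; exact: mem_head.
have {}IH := IH (fun x xr => rG x (@mem_behead _ (g :: r) x xr)).
apply: filterS2 (near_fixes_outside gG) IH => M gM rM x.
by rewrite inE => /predU1P[->|/rM].
Qed.

Lemma mem_derived_commg a b :
  a \in Gamma -> b \in Gamma -> [~ a, b]%g \in derived_subgroup Gamma.
Proof. by move=> aG bG; apply/asboolP => K; apply. Qed.

Lemma derived_sub : {subset derived_subgroup Gamma <= Gamma}.
Proof. by move=> g /asboolP; apply=> y z; exact: gpredR. Qed.

(* If [r] moves the support of [s] off itself, then the commutator of [s^-1]
   and [r] still acts as [s] there. *)
Lemma derived_displacing_element M : 0 < M ->
  exists2 t, t \in derived_subgroup Gamma & displaces M t.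
Proof.
move=> M0; have [s sG sM] := displacing_element M0.
have [N N0 sN] := @common_bound [:: s] ltac:(by move=> ?; rewrite inE => /eqP->).
have {}sN := sN s (mem_head _ _).
have L0 : 0 < Num.max M N by rewrite lt_max M0.
have [r rG rL] := displacing_element L0.
exists [~ s^-1, r]%g; first by apply: mem_derived_commg => //; rewrite gpredV.
rewrite /displaces commgEl invgK conjgE !homeopME.
(* [r] sends [- M] beyond [N], where [s^-1] is the identity, so the commutator and [s] agree at
   [- M]. *)
rewrite (fixes_outsideV sN) ?homeopVK//; apply: lt_le_trans (ler_norm _).
apply: le_lt_trans (lt_le_trans rL _); first by rewrite le_max lexx orbT.
by apply: homeop_le; rewrite lerN2 le_max lexx.
Qed.

(* Multiplying [a] by the conjugate of [a^-1] by [s], and [b] by that of [b^-1]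
   by [s * s], does not change the commutator when [s] displaces the supports. *)
Lemma commg_derivedE a b : a \in Gamma -> b \in Gamma ->
  exists x y, [/\ x \in derived_subgroup Gamma, y \in derived_subgroup Gamma &
    [~ a, b]%g = [~ x, y]%g].
Proof.
move=> aG bG.
have [|M M0 MP] := @common_bound [:: a; b].
  by move=> x; rewrite !inE => /orP[] /eqP->.
have aM : fixes_outside M a by apply: MP; rewrite !inE eqxx.
have bM : fixes_outside M b by apply: MP; rewrite !inE eqxx orbT.
have [s sG sM] := displacing_element M0.
have ssM := displacesM M0 sM sM.
have aVM := fixes_outsideV aM; have bVM := fixes_outsideV bM.
exists [~ a^-1, s]%g, [~ b^-1, s * s]%g; split.
- by apply: mem_derived_commg; rewrite ?gpredV.
- by apply: mem_derived_commg; rewrite ?gpredV ?gpredM.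
rewrite [[~ a^-1, s]%g]commgEl [[~ b^-1, _]%g]commgEl !invgK.
(* The exponents [s] and [s * s] differ so that the two correcting factors also commute with each
   other. *)
have comm : commute (a^-1 ^ s)%g (b^-1 ^ (s * s))%g.
  by rewrite conjgM; apply: commuteJ; exact: displaced_commute sM.
rewrite commgM_commute; last 4 first.
- exact: displaced_commute sM.
- exact: displaced_commute ssM.
- exact: displaced_commute sM.
- exact: displaced_commute ssM.
by rewrite [[~ a^-1 ^ s, _]%g]commgEV comm mulVg mulg1.
Qed.

(** * Commutator width two *)

Definition prod2_commg : {pred homeop R} := fun g => `[< exists a b c d,
  [/\ [/\ a \in Gamma, b \in Gamma, c \in Gamma & d \in Gamma] &
    g = [~ a, b] * [~ c, d]]%g >].

Lemma prod2_commgE a b c d :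
    a \in Gamma -> b \in Gamma -> c \in Gamma -> d \in Gamma ->
  ([~ a, b] * [~ c, d])%g \in prod2_commg.
Proof. by move=> *; apply/asboolP; exists a, b, c, d. Qed.

(** Three commutators collapse to two by [mul3_commg], with [t] chosen so that [t] and [t * t]
    displace a common bound for all six supports. *)
Lemma prod2_commgMr g a b : g \in prod2_commg -> a \in Gamma -> b \in Gamma ->
  (g * [~ a, b])%g \in prod2_commg.
Proof.
move=> /asboolP[a1 [b1 [a2 [b2 [[a1G b1G a2G b2G] ->]]]]] aG bG.
have rG : {subset [:: a1; b1; a2; b2; a; b] <= Gamma}.
  by apply/allP; rewrite /= a1G b1G a2G b2G aG bG.
have [M M0 MP] := common_bound rG.
have [t tG tM] := displacing_element M0.
have ttM := displacesM M0 tM tM.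
rewrite (@mul3_commg _ t).
  by apply: prod2_commgE => //; rewrite ?gpredV;
    repeat (assumption || apply: gpredJ || apply: gpredR || apply: gpredM).
move=> x y xr yr; have yr' : y \in [:: a1; b1; a2; b2; a; b].
  by move: yr; rewrite !inE => /or4P[] ->; rewrite ?orbT.
by rewrite -conjgM; split; apply: displaced_commute; eauto.
Qed.

Lemma prod2_commg1 : 1%g \in prod2_commg.
Proof. by rewrite -[1%g]mulg1 -(commgg 1%g); apply: prod2_commgE; exact: gpred1. Qed.

Lemma prod2_commgM : mulg_closed prod2_commg.
Proof.
move=> g h gP /asboolP[a [b [c [d [[aG bG cG dG] ->]]]]].
by rewrite mulgA; do 2 apply: prod2_commgMr => //.
Qed.

Lemma prod2_commgV : invg_closed prod2_commg.
Proof.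
move=> g /asboolP[a [b [c [d [[aG bG cG dG] ->]]]]].
by rewrite invgM !invgR; exact: prod2_commgE.
Qed.

Definition prod2_commg_group : groupClosed (homeop R) :=
  GroupClosed.Pack (GroupClosed.Class
    (isInvClosed.Build (homeop R) prod2_commg prod2_commgV)
    (isMul1Closed.Build (homeop R) prod2_commg prod2_commg1)
    (isMulClosed.Build (homeop R) prod2_commg prod2_commgM)).

(** [prod2_commg_group] is a subgroup containing all commutators, so minimality of the derived
    subgroup applies. *)
Lemma derived_prod2_commg : {subset derived_subgroup Gamma <= prod2_commg}.
Proof.
move=> g /asboolP/(_ prod2_commg_group); apply=> a b aG bG.
by rewrite -[[~ a, b]%g]mul1g; apply: prod2_commgMr => //; exact: prod2_commg1.
Qed.

Let Gamma' : groupType := subgroup_type (derived_subgroup Gamma).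

(** * Uniform bound on the derived subgroup *)

Section Estimate.
Variables (k : nat) (phi : Gamma' -> 'S_k) (e : R).
Hypothesis phiM :
  forall x y : Gamma', d_hamming R (phi (x * y)%g) (phi x * phi y)%g <= e.

(* Some [t] with [phi t] close to 1 displaces the supports of [a] and [b], so
   that [a, b] = [[a^-1, t], b]. *)
Lemma almost_hom_commg (a b : Gamma') : d_hamming R (phi [~ a, b]%g) 1%g <= 23 * e.
Proof.
have rG : {subset [:: val a; val b] <= Gamma}.
  by apply/allP; rewrite /= !(derived_sub (valP _)).
have [M M0 MP] := common_bound rG.
have aM : fixes_outside M (val a) by apply: MP; rewrite !inE eqxx.
have bM : fixes_outside M (val b) by apply: MP; rewrite !inE eqxx orbT.
have [t tG tM] := derived_displacing_element M0.
have [n le_e] := almost_hom_power phiM (exist _ t tG : Gamma').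
set u := (_ ^+ _)%g in le_e.
have uM : displaces M (val u) by rewrite /u gmulfXn; exact: displacesX.
have aVM := fixes_outsideV aM.
have comm x : fixes_outside M (val x) -> commute x (a^-1 ^ u)%g.
  move=> xM; apply: val_inj; rewrite [LHS]gmulfM [RHS]gmulfM gmulfJ gmulfV.
  exact: displaced_commute uM.
have -> : [~ a, b]%g = [~ [~ a^-1, u], b]%g.
  rewrite [[~ a^-1, u]%g]commgEl invgK -{2}[b]mulg1 commgM_commute ?commg1 ?mulg1//.
  - exact: comm.
  - exact: commute1.
  - exact: comm.
  - exact: commute1.
(* From [u] of length at most [e]: [[~ u, a^-1]] costs [7 * e], its inverse [9 * e], and the outer
   commutator [2 * 9 + 5 = 23] times [e]. *)
have := almost_hom_comm phiM [~ a^-1, u]%g b.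
have := almost_hom_inv phiM [~ u, a^-1]%g; rewrite invgR.
have := almost_hom_comm phiM u a^-1%g; lra.
Qed.

Lemma almost_hom_near_trivial (g : Gamma') : d_hamming R (phi g) 1%g <= 47 * e.
Proof.
have /asboolP[a [b [c [d [[aG bG cG dG] gE]]]]] := derived_prod2_commg (valP g).
have [x [y [xD yD abE]]] := commg_derivedE aG bG.
have [z [w [zD wD cdE]]] := commg_derivedE cG dG.
pose s v (vD : v \in derived_subgroup Gamma) : Gamma' := exist _ v vD.
have -> : g = ([~ s x xD, s y yD] * [~ s z zD, s w wD])%g.
  by apply: val_inj; rewrite gE abE cdE gmulfM !gmulfR.
(* The constant is [47 = 23 + 23 + 1]. *)
have := almost_hom_mul phiM [~ s x xD, s y yD]%g [~ s z zD, s w wD]%g.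
have := almost_hom_commg (s x xD) (s y yD).
have := almost_hom_commg (s z zD) (s w wD); lra.
Qed.

End Estimate.

End Displacement.

(** * Passage to the limit *)

Section Limit.
Context (R : realType) (Gamma : groupClosed (homeop R)).
Hypothesis proxG : proximal Gamma.
Hypothesis bndG : boundedly_supported Gamma.
Let Gamma' : groupType := subgroup_type (derived_subgroup Gamma).

Lemma derived_asymptotically_trivial (k : nat -> nat)
    (phi : forall n, Gamma' -> 'S_(k n)) : uniform_asymptotic_hom R phi ->
  uniformly_asymptotically_close R phi (@trivial_hom Gamma' k).
Proof.
move=> phiM; apply: (squeeze_cvge _ (cvg_cst 0%E)); last first.
  by rewrite -(mule0 47%:E); apply: (cvgeZl _ phiM).
apply: nearW => n; apply/andP; split.
  apply: le_trans (ereal_sup_ubound _); last by exists 1%g.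
  by rewrite lee_fin d_hamming_ge0.
set S := (X in (_ <= _ * X)%E).
have phiMn x y : ((d_hamming R (phi n (x * y)%g) (phi n x * phi n y)%g)%:E <= S)%E.
  by apply: ereal_sup_ubound; exists (x, y).
(* The supremum [S] of the defects is an extended real: at [+oo] the bound is trivial, and [-oo] is
   excluded by the pair [(1, 1)]. *)
apply: ge_ereal_sup => _ [g _ <-]; move: phiMn; case: S => [e| |] phiMn.
- have phiMe x y : d_hamming R (phi n (x * y)%g) (phi n x * phi n y)%g <= e.
    by have := phiMn x y; rewrite lee_fin.
  by rewrite -EFinM lee_fin; exact: (almost_hom_near_trivial proxG bndG phiMe).
- by rewrite gt0_muley ?lte_fin// leey.
- by have := phiMn 1%g 1%g; rewrite leeNy_eq.
Qed.

End Limit.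

Theorem proposition7p7 (R : realType) (Gamma : groupClosed (homeop R)) :
  countable [set g | g \in Gamma]%classic ->
  proximal Gamma ->
  boundedly_supported Gamma ->
  let Gamma' : groupType := subgroup_type (derived_subgroup Gamma) in
  [/\ forall k : nat -> nat, (forall n, (0 < k n)%N) ->
        forall phi : forall n, Gamma' -> 'S_(k n),
        uniform_asymptotic_hom R phi ->
        uniformly_asymptotically_close R phi (@trivial_hom Gamma' k),
      uniformly_S_stable R Gamma' &
      ~ uniformly_S_approximable R Gamma'].
Proof.
move=> _ proxG bndG Gamma'.
have triv := derived_asymptotically_trivial proxG bndG.
split.
- by move=> k _ phi; exact: triv.
- move=> k _ phi phiM.
  by exists (fun n => monoid.one_fun 'S_(k n) : {multiplicative Gamma' -> 'S_(k n)}); exact: triv.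
move=> [k [_ [phi [phiM phi_gt0]]]].
(* An element displacing [[-1, 1]] is nontrivial, yet its distance to the identity tends to 0,
   against the positive lower limit. *)
have [t tG t1] := derived_displacing_element proxG bndG ltr01.
have t_neq1 : (exist _ t tG : Gamma') <> 1%g.
  move=> /(congr1 val)/= t_1.
  by move: t1; rewrite t_1 /displaces homeop1E; lra.
have := phi_gt0 _ t_neq1.
suff /cvg_limn_einf_sup[-> _] : ((d_hamming R (phi n (exist _ t tG)) 1%g)%:E
    @[n --> \oo] --> 0%E)%classic by rewrite ltxx.
apply: (squeeze_cvge _ (cvg_cst 0%E) (triv _ _ phiM)).
apply: nearW => n; rewrite lee_fin d_hamming_ge0/=.
by apply: ereal_sup_ubound; exists (exist _ t tG).
Qed.
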